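(* Let $\vec c=(c_1,c_2,\ldots)$ be a sequence of positive real numbers and $\vec\epsilon=(\epsilon_1,\epsilon_2,\ldots)$ a sequence of nonnegative real numbers, and let $(\vec x,\vec y)$ be the Fibonacci positive specialization of divergent type $$x_k=c_k(k+\epsilon_1+\cdots+\epsilon_{k-1}),\qquad y_k=c_kc_{k+1}(k+\epsilon_1+\cdots+\epsilon_k),\qquad k\ge1.$$ Then for every $n\ge 0$ the associated $n$-th Stieltjes moment is $$a_n=\sum_{\pi\in\Pi(n)}\ \prod_{k\ge1}c_k^{\,\ell_{k-1}(\pi)}(1+\epsilon_k)^{g_k(\pi)},$$ where the sum is over all set partitions $\pi$ of $\{1,\ldots,n\}$.
   Context: Moments: given sequences $\vec x,\vec y$, the associated (normalized, $a_0=1$) Stieltjes moments are the coefficients of the Jacobi continued fraction $$\sum_{n\ge0}a_nz^n=\cfrac{1}{1-x_1z-\cfrac{y_1z^2}{1-x_2z-\cfrac{y_2z^2}{1-x_3z-\ddots}}}\ ;$$ equivalently, $a_n$ is the sum over Motzkin paths of length $n$ (from $(0,0)$ to $(n,0)$, staying weakly above the axis) of the product of step weights, where an up step from height $k-1$ to $k$ has weight $y_k$, a horizontal step at height $k$ has weight $x_{k+1}$, and down steps have weight $1$. Set partition statistics: for $\pi\in\Pi(n)$, list each block in increasing order; $a$ precedes $b$ (and $b$ succeeds $a$) if they are consecutive elements of the same block. An element is a singleton if its block has size one; an opener (resp. closer) if it is the minimum (resp. maximum) of a non-singleton block; a transient otherwise. Let $\mathcal C(\pi)$, $\mathcal T(\pi)$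 be the sets of closers and transients. For $i\in\{1,\ldots,n\}$, $\Gamma_i(\pi)$ is the set of openers or transients $a<i$ such that $i\le b$, where $b$ is the element succeeding $a$ in its block. For $i\in\mathcal C(\pi)\cup\mathcal T(\pi)$, $\gamma_i(\pi)$ is the position (starting from 1) of the element preceding $i$ in its block in the increasing list of the elements of $\Gamma_i(\pi)$. Finally $\ell_k(\pi)=\#\{1\le i\le n:\#\Gamma_i(\pi)=k\}$ for $k\ge0$, and $g_m(\pi)=\#\{i\in\mathcal C(\pi)\cup\mathcal T(\pi):\gamma_i(\pi)=m\}$ for $m\ge1$. *)

(* Defs.v *)
From mathcomp Require Import all_boot all_order all_algebra.
From mathcomp Require Import reals.

Set Implicit Arguments.
Unset Strict Implicit.
Unset Printing Implicit Defensive.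

Import GRing.Theory.
Local Open Scope ring_scope.

(* Formal power series over R, as coefficient sequences. *)

Definition fps_one (R : fieldType) : nat -> R := fun n => (n == 0%N)%:R.

Definition fps_mul (R : fieldType) (f g : nat -> R) : nat -> R :=
  fun n => \sum_(i < n.+1) f i * g (n - i)%N.

(* The first n coefficients of 1/f. *)
Fixpoint fps_inv_prefix (R : fieldType) (f : nat -> R) (n : nat) : seq R :=
  if n is m.+1 then
    let s := fps_inv_prefix f m in
    rcons s ((f 0%N)^-1 *
             (fps_one R m - \sum_(i < m) f (m - i)%N * s`_i))
  else [::].

Definition fps_inv (R : fieldType) (f : nat -> R) : nat -> R :=
  fun n => (fps_inv_prefix f n.+1)`_n.

(* The series 1 - a z - b z^2 g(z). *)
Definition jdenom (R : fieldType) (a b : R) (g : nat -> R) : nat -> R :=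
  fun n => match n with
           | 0 => 1
           | 1 => - a
           | m.+2 => - (b * g m)
           end.

(* The N-th convergent of the Jacobi continued fraction
     1/(1 - x_k z - y_k z^2/(1 - x_(k+1) z - y_(k+1) z^2/...)),
   with N levels kept and the remaining tail replaced by 0. *)
Fixpoint jconvergent (R : fieldType) (x y : nat -> R) (N k : nat) : nat -> R :=
  if N is M.+1 then fps_inv (jdenom (x k) (y k) (jconvergent x y M k.+1))
  else fun=> 0.

(* The value of the infinite fraction: the coefficient of z^n is the same in all
   convergents with N > n (jconvergent_stable); it satisfies the
   functional equation jfractionE. *)
Definition jfraction (R : fieldType) (x y : nat -> R) (k : nat) : nat -> R :=
  fun n => jconvergent x y n.+1 k n.

Definition stieltjes_moment (R : fieldType) (x y : nat -> R) (n : nat) : R :=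
  jfraction x y 1 n.

Lemma size_fps_inv_prefix (R : fieldType) (f : nat -> R) n :
  size (fps_inv_prefix f n) = n.
Proof. by elim: n => //= n IHn; rewrite size_rcons IHn. Qed.

Lemma nth_fps_inv_prefix (R : fieldType) (f : nat -> R) n i :
  (i < n)%N -> (fps_inv_prefix f n)`_i = fps_inv f i.
Proof.
elim: n => // n IHn; rewrite ltnS leq_eqVlt => /orP[/eqP->//|lt_in].
by rewrite /= nth_rcons size_fps_inv_prefix lt_in IHn.
Qed.

Lemma fps_invE (R : fieldType) (f : nat -> R) n :
  fps_inv f n =
  (f 0%N)^-1 * (fps_one R n - \sum_(i < n) f (n - i)%N * fps_inv f i).
Proof.
rewrite {1}/fps_inv /= nth_rcons size_fps_inv_prefix ltnn eqxx.
by congr (_ * (_ - _)); apply: eq_bigr => i _; rewrite nth_fps_inv_prefix.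
Qed.

Lemma fps_mulV (R : fieldType) (f : nat -> R) :
  f 0%N != 0 -> fps_mul f (fps_inv f) =1 fps_one R.
Proof.
move=> f0 n; rewrite /fps_mul (reindex_inj rev_ord_inj) big_ord_recr /=.
rewrite subSS subnn subn0 fps_invE mulVKf //.
rewrite [X in X + _](_ : _ = \sum_(i < n) f (n - i)%N * fps_inv f i).
  by rewrite addrC subrK.
apply: eq_bigr => i _; rewrite subSS subKn //.
exact: ltnW.
Qed.

Lemma eq_fps_inv (R : fieldType) (f g : nat -> R) n :
  (forall i, (i <= n)%N -> f i = g i) -> fps_inv f n = fps_inv g n.
Proof.
elim/ltn_ind: n => n IHn fg; rewrite !fps_invE fg //.
congr (_ * (_ - _)); apply: eq_bigr => i _; rewrite fg ?leq_subr //.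
rewrite (IHn i) // => j le_ji; apply: fg.
exact: leq_trans le_ji (ltnW (ltn_ord i)).
Qed.

Lemma jconvergent_stable (R : fieldType) (x y : nat -> R) N k n :
  (n < N)%N -> jconvergent x y N k n = jfraction x y k n.
Proof.
rewrite /jfraction => ltnN.
move: (ltnSn n); move: {-1}n.+1 => M ltnM; move: ltnM ltnN.
elim: N M k n => [|N IHN] [|M] k n //= ltnM ltnN.
apply: eq_fps_inv => -[|[|i]] //= lin; congr (- (_ * _)).
by apply: IHN; apply: leq_trans (ltnW lin) _.
Qed.

Lemma jfractionE (R : fieldType) (x y : nat -> R) k :
  fps_mul (jdenom (x k) (y k) (jfraction x y k.+1)) (jfraction x y k)
  =1 fps_one R.
Proof.
move=> n; rewrite -(@fps_mulV _ (jdenom (x k) (y k) (jfraction x y k.+1))).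
  apply: eq_bigr => i _; congr (_ * _).
  rewrite /jfraction /=; apply: eq_fps_inv => -[|[|j]] //= lj.
  by rewrite jconvergent_stable // (leq_trans _ lj).
by rewrite /= oner_eq0.
Qed.

(* Sequences are indexed from 1: the values at 0 are irrelevant. *)

Definition divergent_x (R : realType) (c eps : nat -> R) (k : nat) : R :=
  c k * (k%:R + \sum_(1 <= i < k) eps i).

Definition divergent_y (R : realType) (c eps : nat -> R) (k : nat) : R :=
  c k * c k.+1 * (k%:R + \sum_(1 <= i < k.+1) eps i).

(* Set partition statistics. The ground set {1, ..., n} is 'I_n, the ordinal i
   standing for the element i + 1; all the statistics depend only on the order. *)

Definition precedes (n : nat) (P : {set {set 'I_n}}) (a b : 'I_n) : bool :=
  [&& b \in pblock P a, (a < b)%N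
    & [forall j in pblock P a, ~~ ((a < j)%N && (j < b)%N)]].

Definition singleton (n : nat) (P : {set {set 'I_n}}) (i : 'I_n) : bool :=
  #|pblock P i| == 1%N.

Definition opener (n : nat) (P : {set {set 'I_n}}) (i : 'I_n) : bool :=
  ~~ singleton P i && [forall j in pblock P i, (i <= j)%N].

Definition closer (n : nat) (P : {set {set 'I_n}}) (i : 'I_n) : bool :=
  ~~ singleton P i && [forall j in pblock P i, (j <= i)%N].

Definition transient (n : nat) (P : {set {set 'I_n}}) (i : 'I_n) : bool :=
  [&& ~~ singleton P i, ~~ opener P i & ~~ closer P i].

Definition Gamma (n : nat) (P : {set {set 'I_n}}) (i : 'I_n) : {set 'I_n} :=
  [set a : 'I_n | [&& opener P a || transient P a, (a < i)%N
                    & [exists b, precedes P a b && (i <= b)%N]]].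

(* enum lists a subset of 'I_n in increasing order. The None case does not occur
   when i is a closer or a transient. *)
Definition gamma (n : nat) (P : {set {set 'I_n}}) (i : 'I_n) : nat :=
  if [pick a | precedes P a i] is Some a then (index a (enum (Gamma P i))).+1
  else 0.

Definition ell (n : nat) (P : {set {set 'I_n}}) (k : nat) : nat :=
  #|[set i : 'I_n | #|Gamma P i| == k]|.

Definition gstat (n : nat) (P : {set {set 'I_n}}) (m : nat) : nat :=
  #|[set i : 'I_n | (closer P i || transient P i) && (gamma P i == m)]|.

(* The two bounds below justify truncating products over k >= 1 at k = n. *)

Lemma card_Gamma (n : nat) (P : {set {set 'I_n}}) (i : 'I_n) :
  (#|Gamma P i| <= i)%N.
Proof.
have le_in : (i <= n)%N by apply: ltnW.
rewrite -[X in (_ <= X)%N]card_ord.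
apply: leq_trans (leq_imset_card (widen_ord le_in) _); apply/subset_leq_card/subsetP => a; rewrite inE => /and3P[_ lt_ai _].
by apply/imsetP; exists (Ordinal lt_ai) => //; apply: val_inj.
Qed.

Lemma ell_gt (n : nat) (P : {set {set 'I_n}}) (k : nat) :
  (n <= k)%N -> ell P k = 0%N.
Proof.
move=> le_nk; apply/eqP; rewrite cards_eq0; apply/eqP/setP => i.
rewrite !inE; apply/negbTE; rewrite neq_ltn (leq_ltn_trans (card_Gamma P i)) //.
exact: leq_trans (ltn_ord i) le_nk.
Qed.

Lemma gstat_gt (n : nat) (P : {set {set 'I_n}}) (m : nat) :
  (n < m)%N -> gstat P m = 0%N.
Proof.
move=> lt_nm; apply/eqP; rewrite cards_eq0; apply/eqP/setP => i.
rewrite !inE; apply/negbTE/nandP; right.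
rewrite neq_ltn (leq_ltn_trans _ lt_nm) // /gamma.
case: pickP => // a _; apply: leq_ltn_trans (ltn_ord i).
by apply: leq_trans (index_size _ _) _; rewrite -cardE card_Gamma.
Qed.

(* Main.v *)
Require Import Defs.
From mathcomp Require Import all_boot all_order all_algebra.
From mathcomp Require Import reals.
From mathcomp Require Import ring.

Set Implicit Arguments.
Unset Strict Implicit.
Unset Printing Implicit Defensive.

Import Order.TTheory GRing.Theory Num.Theory.
Local Open Scope ring_scope.

(* Scan the elements of {1, ..., n} in increasing order and follow the height
   #Gamma_i. At height h, the next element i contributes c_(h+1), and is either
   a singleton, an opener (height + 1), or is attached to one of the h elements of
   Gamma_i, which closes the block (height - 1) or not; attaching it to the m-th
   one contributes 1 + eps_m. The contribution thus depends on Gamma_i only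
   through its cardinality, and summing over the choices gives a Motzkin path
   with up steps c_(h+1), horizontal steps
     c_(h+1) (1 + sum_(m <= h) (1 + eps_m)) = x_(h+1),
   and down steps from h + 1 equal to c_(h+2) sum_(m <= h+1) (1 + eps_m). The
   product of the up step from h and the down step from h + 1 is y_(h+1). *)

(** * Continued fraction coefficients as sums over Motzkin paths *)

Definition fps_shift (R : fieldType) (f : nat -> R) : nat -> R :=
  fun n => if n is m.+1 then f m else 0.

(** Truncation transfers the ring laws of [{poly R}], here associativity, to the product of
    series. *)
Lemma fps_mul_poly (R : fieldType) (f g : nat -> R) N n : (n < N)%N ->
  fps_mul f g n = (\poly_(i < N) f i * \poly_(i < N) g i)`_n.
Proof.
move=> ltnN; rewrite coefM; apply: eq_bigr => i _.
by rewrite !coef_poly !(leq_ltn_trans _ ltnN) ?leq_subr // -ltnS.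
Qed.

Lemma fps_mulA (R : fieldType) (f g h : nat -> R) n :
  fps_mul f (fps_mul g h) n = fps_mul (fps_mul f g) h n.
Proof.
pose p (u : nat -> R) := \poly_(i < n.+1) u i.
transitivity (p f * (p g * p h))`_n; last rewrite mulrA.
  rewrite coefM; apply: eq_bigr => i _; rewrite coef_poly ltn_ord.
  by rewrite (@fps_mul_poly _ _ _ n.+1) // ltnS leq_subr.
rewrite coefM; apply: eq_bigr => i _; rewrite [(p h)`__]coef_poly.
by rewrite ltnS leq_subr (@fps_mul_poly _ _ _ n.+1).
Qed.

Lemma fps_mul_shiftl (R : fieldType) (f g : nat -> R) n :
  fps_mul (fps_shift f) g n = fps_shift (fps_mul f g) n.
Proof.
rewrite /fps_mul big_ord_recl /= mul0r add0r; case: n => [|n] /=.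
  by rewrite big_ord0.
by apply: eq_bigr => i _; rewrite /bump /= add1n subSS.
Qed.

Lemma fps_mul_shiftr (R : fieldType) (f g : nat -> R) n :
  fps_mul f (fps_shift g) n = fps_shift (fps_mul f g) n.
Proof.
rewrite /fps_mul big_ord_recr /= subnn mulr0 addr0; case: n => [|n] /=.
  by rewrite big_ord0.
by apply: eq_bigr => i _; rewrite subSn // -ltnS.
Qed.

Lemma fps_mulZr (R : fieldType) (f g : nat -> R) a n :
  fps_mul f (fun i => a * g i) n = a * fps_mul f g n.
Proof.
by rewrite /fps_mul mulr_sumr; apply: eq_bigr => i _; rewrite mulrCA.
Qed.

Lemma jfraction0 (R : fieldType) (x y : nat -> R) k : jfraction x y k 0 = 1.
Proof.
by have := jfractionE x y k 0; rewrite /fps_mul big_ord1 /= mul1r subnn.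
Qed.

(** Clearing the denominator gives F_k = 1 + x_k z F_k + y_k z^2 F_(k+1) F_k, where F_k is
    [jfraction x y k]; compare coefficients. *)
Lemma jfractionS (R : fieldType) (x y : nat -> R) k n :
  jfraction x y k n.+1 = x k * jfraction x y k n +
    y k * fps_shift (fps_mul (jfraction x y k.+1) (jfraction x y k)) n.
Proof.
have := jfractionE x y k n.+1.
rewrite /fps_mul /fps_one /= 2!big_ord_recl /= /bump /= !add1n subn0 subn1 /=.
rewrite mul1r mulNr => /eqP; rewrite addr_eq0 opprD opprK => /eqP ->.
congr (_ + _); case: n => [|n] /=; first by rewrite big_ord0 mulr0 oppr0.
rewrite -sumrN mulr_sumr; apply: eq_bigr => i _.
by rewrite /bump /= !add1n !subSS mulNr opprK mulrA.
Qed.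

Lemma fps_mul_jfractionS (R : fieldType) (x y g : nat -> R) k n :
  fps_mul (jfraction x y k) g n.+1 =
  g n.+1 + x k * fps_mul (jfraction x y k) g n +
  y k * fps_shift (fps_mul (jfraction x y k.+1) (fps_mul (jfraction x y k) g)) n.
Proof.
rewrite {1}/fps_mul big_ord_recl jfraction0 mul1r subn0 -addrA; congr (_ + _).
under eq_bigr => i _.
  rewrite subSS jfractionS mulrDl -!mulrA; over.
rewrite big_split -!mulr_sumr /=; congr (_ + _ * _).
rewrite -[LHS]/(fps_mul _ _ n) fps_mul_shiftl.
by case: n => //= n; rewrite fps_mulA.
Qed.

(* Total weight of the paths with n steps from height h to 0; [down g] is the
   weight of the step from g + 1 to g. *)
Fixpoint motzkin (R : fieldType) (up hor down : nat -> R) (n h : nat) : R :=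
  if n is m.+1 then
    hor h * motzkin up hor down m h + up h * motzkin up hor down m h.+1 +
    (if h is g.+1 then down g * motzkin up hor down m g else 0)
  else (h == 0%N)%:R.

(* Cutting a path at its last visits to the heights h, ..., 1 gives the series
   z^h d_0 ... d_(h-1) F_(h+1) ... F_1. *)
Fixpoint descent (R : fieldType) (down x y : nat -> R) (h : nat) : nat -> R :=
  if h is g.+1 then
    fps_shift (fun n =>
      down g * fps_mul (jfraction x y h.+1) (descent down x y g) n)
  else jfraction x y 1.

(** Expand the outermost factor F_(h+1) by its functional equation. For h > 0 the term 1 leaves the
    down step; x_(h+1) z gives a horizontal step; y_(h+1) z^2 F_(h+2) splits into an up step and the
    down step contained in [descent] at height h + 1. *)
Lemma descentS (R : fieldType) (up down x y : nat -> R) h n :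
  (forall g, up g * down g = y g.+1) ->
  descent down x y h n.+1 =
  x h.+1 * descent down x y h n + up h * descent down x y h.+1 n +
  (if h is g.+1 then down g * descent down x y g n else 0).
Proof.
move=> updown; case: h => [|h].
  rewrite [descent _ _ _ 0]/= jfractionS addr0 -updown; congr (_ + _).
  by case: n => [|n] /=; rewrite ?mulr0 // mulrA.
case: n => [|n].
  by rewrite /= /fps_mul big_ord1 subnn jfraction0 mul1r !mulr0 !add0r.
rewrite [descent _ _ _ _ n.+2]/= fps_mul_jfractionS -updown.
rewrite [descent _ _ _ h.+1 _]/= [descent _ _ _ h.+2 n.+1]/=.
rewrite fps_mul_shiftr.
case: n => [|n] /=; first by ring.
by rewrite fps_mulZr; ring.
Qed.

Lemma descentE (R : fieldType) (up hor down x y : nat -> R) h n :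
  (forall g, up g * down g = y g.+1) -> (forall g, hor g = x g.+1) ->
  descent down x y h n = motzkin up hor down n h.
Proof.
move=> updown horE; elim: n h => [|n IHn] h.
  by case: h => //=; rewrite jfraction0.
rewrite (descentS _ _ _ updown) !IHn -horE.
by case: h => [|h] //; rewrite IHn.
Qed.

Lemma stieltjes_momentE (R : fieldType) (up hor down x y : nat -> R) n :
  (forall g, up g * down g = y g.+1) -> (forall g, hor g = x g.+1) ->
  stieltjes_moment x y n = motzkin up hor down n 0.
Proof. by move=> updown horE; rewrite -(descentE 0 n updown horE). Qed.

(** * Arc diagrams and the arcs crossing a position *)

(* A set partition is encoded by the map sending each element to the element
   preceding it in its block, if any. *)
Definition pred_fun n := {ffun 'I_n -> option 'I_n}.

(** Arcs go upward and no element starts two of them; that none ends two is built into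
    [pred_fun]. *)
Definition arc_diagram n (p : pred_fun n) : bool :=
  [forall b, forall a, (p b == Some a) ==>
     (a < b)%N && [forall b', (p b' == Some a) ==> (b' == b)]].

(* For the diagram of a partition, crossing p i is Gamma_i. *)
Definition crossing n (p : pred_fun n) (m : nat) : {set 'I_n} :=
  [set a : 'I_n | (a < m)%N && [exists b : 'I_n, (p b == Some a) && (m <= b)%N]].

Lemma arc_diagramP n (p : pred_fun n) :
  reflect (forall a b, p b = Some a ->
             (a < b)%N /\ forall b', p b' = Some a -> b' = b)
          (arc_diagram p).
Proof.
apply: (iffP forallP) => [arcs a b pb | arcs b].
  have /forallP/(_ a) := arcs b; rewrite pb eqxx /= => /andP[-> /forallP uniq_b].
  by split=> // b' pb'; have := uniq_b b'; rewrite pb' eqxx => /eqP.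
apply/forallP=> a; apply/implyP=> /eqP/arcs[-> uniq_b] /=.
by apply/forallP=> b'; apply/implyP=> /eqP/uniq_b/eqP.
Qed.

Lemma crossingP n (p : pred_fun n) m (a : 'I_n) :
  reflect ((a < m)%N /\ exists2 b : 'I_n, p b = Some a & (m <= b)%N)
          (a \in crossing p m).
Proof.
rewrite inE; apply: (iffP andP) => -[-> ].
  by case/existsP=> b /andP[/eqP pb mb]; split=> //; exists b.
by case=> b pb mb; split=> //; apply/existsP; exists b; rewrite pb eqxx.
Qed.

(** * Summing the weights of diagrams element by element *)

Definition step_weight (R : fieldType) (c w : nat -> R) n (p : pred_fun n)
    (i : 'I_n) : R :=
  c #|crossing p i| *
  (if p i is Some a then w (index a (enum (crossing p i))) else 1).

(** Along [enum A] the positions take each value below [#|A|] once, so only the size of [A]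
    matters. *)
Lemma sum_index_enum (R : fieldType) (T : finType) (A : {set T}) (w : nat -> R) :
  \sum_(a in A) w (index a (enum A)) = \sum_(i < #|A|) w i.
Proof.
have [->|[x0 _]] := set_0Vmem A; first by rewrite big_set0 cards0 big_ord0.
rewrite -big_enum (big_nth x0) big_mkord -cardE; apply: eq_bigr => i _.
by rewrite index_uniq ?enum_uniq // -cardE.
Qed.

(* Diagrams on the elements >= m whose arcs arriving from below m start at A. *)
Definition completions n (m : nat) (A : {set 'I_n}) (p : pred_fun n) : bool :=
  [&& arc_diagram p, [forall i : 'I_n, (i < m)%N ==> (p i == None)]
    & crossing p m == A].

Definition reset n (p : pred_fun n) (i : 'I_n) (o : option 'I_n) : pred_fun n :=
  [ffun j => if j == i then o else p j].

(* Transition from Gamma_i = A to Gamma_(i+1), when o is the predecessor of i and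
   b tells whether i has a successor. *)
Definition cross_step n (A : {set 'I_n}) (i : 'I_n) (o : option 'I_n) (b : bool) :
    {set 'I_n} :=
  (if o is Some a then A :\ a else A) :|: (if b then [set i] else set0).

Lemma completionsP n m (A : {set 'I_n}) (p : pred_fun n) :
  reflect [/\ arc_diagram p, forall i : 'I_n, (i < m)%N -> p i = None
            & crossing p m = A] (completions m A p).
Proof.
apply: (iffP and3P) => -[arcs none /eqP->]; split=> //.
  by move=> i lim; have /forallP/(_ i)/implyP/(_ lim)/eqP := none.
by apply/forallP=> i; apply/implyP=> /none->.
Qed.

Lemma crossing_reset n (p : pred_fun n) (i : 'I_n) o m : (i < m)%N ->
  crossing (reset p i o) m = crossing p m.
Proof.
move=> lim; apply/setP=> a; rewrite !inE; congr (_ && _).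
apply: eq_existsb => b; rewrite ffunE; case: (b =P i) => // ->.
by rewrite [(m <= i)%N]leqNgt lim !andbF.
Qed.

Lemma reset_reset n (p : pred_fun n) i o o' :
  reset (reset p i o) i o' = reset p i o'.
Proof. by apply/ffunP=> j; rewrite !ffunE; case: eqP. Qed.

Lemma reset_id n (p : pred_fun n) i : reset p i (p i) = p.
Proof. by apply/ffunP=> j; rewrite !ffunE; case: eqP => // ->. Qed.

Definition allowed n (A : {set 'I_n}) (o : option 'I_n) : bool :=
  if o is Some a then a \in A else true.

Lemma in_cross_step n (A : {set 'I_n}) i o b a :
  (a \in cross_step A i o b) = ((a \in A) && (o != Some a)) || (b && (a == i)).
Proof.
rewrite inE; congr (_ || _); last by case: b; rewrite inE.
by case: o => [a'|]; rewrite ?andbT // !inE andbC eq_sym.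
Qed.

(** An arc crossing at [i] but not at [i.+1] ends at [i], and a source has only one arc, so only
    [p i] is lost; the only possible new source is [i]. *)
Lemma crossingS n (p : pred_fun n) (i : 'I_n) : arc_diagram p ->
  crossing p i.+1 = cross_step (crossing p i) i (p i) (i \in crossing p i.+1).
Proof.
move/arc_diagramP=> arcs; apply/setP=> a; rewrite in_cross_step.
have [->|nai] := eqVneq a i.
  have /negbTE -> : i \notin crossing p i.
    by apply/negP=> /crossingP[]; rewrite ltnn.
  by rewrite andbT.
rewrite andbF orbF; apply/crossingP/andP => [[lai [j pj lij]]|].
  split.
    apply/crossingP; split; last by exists j; rewrite // ltnW.
    by rewrite ltn_neqAle nai -ltnS.
  apply: contraTneq lij => pi.
  by have [_ /(_ _ pi) <-] := arcs _ _ pj; rewrite ltnn.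
case=> /crossingP[lai [j pj lij]] npi; split; first by rewrite ltnS ltnW.
exists j => //; rewrite ltn_neqAle lij andbT.
by apply: contraNneq npi => /val_inj->; rewrite pj.
Qed.

Lemma completions_reset n (i : 'I_n) (A : {set 'I_n}) (p : pred_fun n) :
  completions i A p ->
  completions i.+1 (cross_step A i (p i) (i \in crossing p i.+1)) (reset p i None).
Proof.
case/completionsP=> arcs none cr; apply/completionsP; split.
- apply/arc_diagramP=> a j; rewrite ffunE; case: eqP => // _.
  case/(arc_diagramP _ arcs) => laj uj; split=> // j'; rewrite ffunE.
  by case: eqP => // _ /uj.
- move=> j lji; rewrite ffunE; have [//|nji] := eqVneq j i.
  by apply: none; rewrite ltn_neqAle nji -ltnS.
by rewrite crossing_reset // -cr -crossingS.
Qed.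

Lemma completions_set n (i : 'I_n) (A : {set 'I_n}) o b (q : pred_fun n) :
  (forall a, a \in A -> (a < i)%N) -> allowed A o ->
  completions i.+1 (cross_step A i o b) q ->
  completions i A (reset q i o) && ((i \in crossing (reset q i o) i.+1) == b).
Proof.
move=> ltA okA /completionsP[/arc_diagramP arcs none cr].
have niA : i \notin A by apply/negP=> /ltA; rewrite ltnn.
have qlt a j : q j = Some a -> j != i /\ (i < j)%N.
  move=> qj; suff lij : (i < j)%N by rewrite neq_ltn lij orbT.
  by rewrite ltnNge; apply/negP=> lji; rewrite none in qj.
(* A source of [q] below [i] survives in [cross_step], hence differs from [o]: the new arc into [i]
   gives no element a second outgoing arc. *)
have crA a j : q j = Some a -> (a < i)%N -> a \in A /\ o <> Some a.
  move=> qj lai; have : a \in crossing q i.+1.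
    apply/crossingP; split; first exact: ltnW.
    by exists j => //; case: (qlt _ _ qj).
  have nai : a != i by apply: contraTneq lai => ->; rewrite ltnn.
  by rewrite cr in_cross_step (negbTE nai) andbF orbF => /andP[? /eqP].
have ri : reset q i o i = o by rewrite ffunE eqxx.
have rE j : j != i -> reset q i o j = q j by rewrite ffunE => /negbTE->.
apply/andP; split; last first.
  by rewrite crossing_reset // cr in_cross_step (negbTE niA) eqxx andbT.
apply/completionsP; split.
- apply/arc_diagramP=> a j; have [->|ji] := eqVneq j i.
    rewrite ri => oa; have lai : (a < i)%N by apply: ltA; rewrite oa in okA.
    split=> // j'; have [->//|j'i] := eqVneq j' i.
    by rewrite rE // => qj'; have [] := crA _ _ qj' lai.
  rewrite rE // => qj; have [laj uj] := arcs _ _ qj; split=> // j'.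
  have [->|j'i] := eqVneq j' i; last by rewrite rE // => /uj.
  rewrite ri => oa; have lai : (a < i)%N by apply: ltA; rewrite oa in okA.
  by have [] := crA _ _ qj lai.
- move=> j lji; rewrite rE ?none //; first exact: ltnW.
  by apply: contraTneq lji => ->; rewrite ltnn.
apply/setP=> a; apply/crossingP/idP => [[lai [j]]|aA].
  have [->|ji] := eqVneq j i; first by rewrite ri => oa; rewrite oa in okA.
  by rewrite rE // => /crA/(_ lai)[].
split; first exact: ltA.
have [oa|/eqP noa] := eqVneq o (Some a); first by exists i; rewrite ?ri.
have : a \in crossing q i.+1.
  by rewrite cr in_cross_step aA; move/eqP: noa => ->.
case/crossingP=> _ [j qj lij]; exists j; last exact: ltnW.
by rewrite rE //; case: (qlt _ _ qj).
Qed.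

(** Since an allowed predecessor lies in [A], the truncated subtraction is exact; since [i] is
    outside [A], the union is disjoint. *)
Lemma card_cross_step n (A : {set 'I_n}) i o b :
  i \notin A -> allowed A o -> #|cross_step A i o b| = (#|A| - (o != None) + b)%N.
Proof.
move=> niA okA; rewrite cardsU -[RHS]subn0; congr (_ - _)%N.
  congr (_ + _)%N; last by case: b; rewrite ?cards1 ?cards0.
  case: o okA => [a aA|_]; last by rewrite subn0.
  by rewrite (cardsD1 a A) (aA : a \in A) add1n subn1.
apply: eq_card0 => a; rewrite inE; apply/negbTE/negP => /andP[].
case: b; rewrite inE // => + /eqP ai; rewrite ai.
by case: o okA => [a' _|_]; rewrite ?inE (negbTE niA) ?andbF.
Qed.

Lemma allowed_crossing n (p : pred_fun n) (i : 'I_n) :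
  arc_diagram p -> allowed (crossing p i) (p i).
Proof.
move/arc_diagramP=> arcs; case pi: (p i) => [a|//].
by apply/crossingP; split; [case: (arcs _ _ pi) | exists i].
Qed.

Lemma big_allowed (R : fieldType) n (A : {set 'I_n}) (F : option 'I_n -> R) :
  \sum_(o | allowed A o) F o = F None + \sum_(a in A) F (Some a).
Proof.
rewrite (bigD1 None) //=; congr (_ + _).
rewrite (reindex_omap Some id) //=; last by case.
by apply: eq_bigl => a; rewrite eqxx !andbT.
Qed.

(** Deleting and restoring the arc into [i] are inverse bijections. They leave the crossing sets
    after [i] unchanged, so the factor of [i] splits off and the later factors are preserved. *)
Lemma sum_completions_step (R : fieldType) (c w : nat -> R) n (i : 'I_n)
    (A : {set 'I_n}) o b :
  (forall a, a \in A -> (a < i)%N) -> allowed A o ->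
  \sum_(p | completions i A p && ((p i, i \in crossing p i.+1) == (o, b)))
     \prod_(j < n | (i <= j)%N) step_weight c w p j =
  c #|A| * (if o is Some a then w (index a (enum A)) else 1) *
  \sum_(q | completions i.+1 (cross_step A i o b) q)
     \prod_(j < n | (i < j)%N) step_weight c w q j.
Proof.
move=> ltA okA.
rewrite (reindex_onto (fun q => reset q i o) (fun p => reset p i None)) /=;
  last first.
  by move=> p /andP[_ /eqP[<- _]]; rewrite reset_reset reset_id.
rewrite mulr_sumr; apply: eq_big => [q|q /andP[/andP[/completionsP[_ _ cr] _] _]].
  apply/idP/idP => [/andP[/andP[+ /eqP[po cb]] /eqP qE]|cq].
    by move/completions_reset; rewrite po cb qE.
  have /andP[-> /eqP ->] := completions_set ltA okA cq.
  have [_ none _] := completionsP _ _ _ cq.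
  by rewrite ffunE eqxx reset_reset -{2}(reset_id q i) none ?eqxx.
rewrite (bigD1 i) //=; congr (_ * _).
  by rewrite /step_weight cr ffunE eqxx.
apply: eq_big => [j|j /andP[lij nji]]; first by rewrite ltn_neqAle andbC eq_sym.
have {}lij : (i < j)%N by rewrite ltn_neqAle eq_sym nji.
by rewrite /step_weight crossing_reset // ffunE (negbTE nji).
Qed.

Lemma sum_completions (R : fieldType) (c w : nat -> R) n m (A : {set 'I_n}) :
  (m <= n)%N -> (forall a, a \in A -> (a < m)%N) ->
  \sum_(p | completions m A p) \prod_(i < n | (m <= i)%N) step_weight c w p i =
  motzkin c (fun h => c h * (1 + \sum_(j < h) w j))
    (fun h => c h.+1 * \sum_(j < h.+1) w j) (n - m) #|A|.
Proof.
move=> lemn; move: {2}(n - m)%N (erefl (n - m)%N) => d.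
elim: d m A lemn => [|d IHd] m A lemn nm ltA.
  (* Past the last element only the empty diagram is left, and no arc crosses: the path has ended
     and its height must be 0. *)
  have {lemn nm ltA} ->: m = n by apply/eqP; rewrite eqn_leq lemn -subn_eq0 nm.
  pose p0 : pred_fun n := [ffun=> None].
  have cr p : @crossing n p n = set0.
    apply/setP=> a; rewrite [in RHS]inE; apply/negP=> /crossingP[_ [b _]].
    by rewrite leqNgt ltn_ord.
  rewrite subnn /= cards_eq0 (eq_bigl (fun p => (A == set0) && (p == p0))).
    have [_|_] := eqVneq A set0; last by rewrite big_pred0.
    by rewrite big_pred1_eq big_pred0 // => i; rewrite leqNgt ltn_ord.
  move=> p; apply/completionsP/andP => [[_ none <-]|[/eqP-> /eqP->]].
    by rewrite cr eqxx; split=> //; apply/eqP/ffunP => i; rewrite ffunE none.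
  split=> [|i _|]; rewrite ?ffunE ?cr //.
  by apply/arc_diagramP=> a b; rewrite ffunE.
have ltmn : (m < n)%N by rewrite -subn_gt0 nm.
have [i mi] : exists i : 'I_n, m = i by exists (Ordinal ltmn).
rewrite {m lemn}mi in ltmn nm ltA *.
have niA : i \notin A by apply/negP=> /ltA; rewrite ltnn.
(* Sort the diagrams by the predecessor of [i] and by whether [i] has a successor. *)
rewrite (partition_big (fun p : pred_fun n => (p i, i \in crossing p i.+1))
           (fun ob => allowed A ob.1 && true)) /=; last first.
  move=> p /completionsP[arcs _ <-]; rewrite andbT.
  exact: (@allowed_crossing n p i).
rewrite -(pair_big_dep (allowed A) (fun _ _ => true) (fun o b => 
 \sum_(p | completions i A p && ((p i, i \in crossing p i.+1) == (o, b)))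
     \prod_(j < n | (i <= j)%N) step_weight c w p j)) /=.
under eq_bigr => o okA.
  under eq_bigr => b _.
    rewrite sum_completions_step // IHd //=; first last.
    - move=> a; rewrite in_cross_step ltnS => /orP[/andP[/ltA/ltnW//]|].
      by case/andP=> _ /eqP->.
    - by rewrite subnS nm.
    rewrite card_cross_step // subnS nm /=; over.
  over.
rewrite big_allowed !big_bool /= subn0 addn0 addn1 nm /=.
set M := motzkin _ _ _ _.
(* Attaching [i] to an element of [A] keeps the height if [i] is continued and lowers it by one
   otherwise. *)
have -> : \sum_(a in A) \sum_(b : bool)
    c #|A| * w (index a (enum A)) * M (#|A| - 1 + b)%N =
  c #|A| * (M #|A| + M (#|A|.-1)) * \sum_(j < #|A|) w j.
  rewrite -sum_index_enum mulr_sumr; apply: eq_bigr => a aA.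
  rewrite big_bool /= addn0 addn1 subn1 prednK; first by ring.
  by apply/card_gt0P; exists a.
(* At height 0 the sum over attachments is empty, matching the missing down step of [motzkin]. *)
by case: #|A| => [|k]; rewrite ?big_ord0 /=; ring.
Qed.

(** * From set partitions to arc diagrams, with their statistics *)

Lemma precedesP n (P : {set {set 'I_n}}) (a b : 'I_n) :
  reflect [/\ b \in pblock P a, (a < b)%N
            & forall j, j \in pblock P a -> (a < j)%N -> (b <= j)%N]
          (precedes P a b).
Proof.
apply: (iffP and3P) => -[ab lab min_b]; split=> //.
  move=> j aj laj; have /forallP/(_ j) := min_b.
  by rewrite aj laj /= -leqNgt.
apply/forallP=> j; apply/implyP=> aj.
by rewrite negb_and -!leqNgt; case: leqP => //= /min_b->.
Qed.

Section Partition.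

Variables (n : nat) (P : {set {set 'I_n}}).
Hypothesis partP : partition P [set: 'I_n].

Let tiP : trivIset P. Proof. by case/and3P: partP. Qed.
Let coverP i : i \in cover P. Proof. by rewrite (cover_partition partP) inE. Qed.
Let pblock_eq i j : (j \in pblock P i) = (pblock P i == pblock P j).
Proof. by rewrite eq_pblock. Qed.

Lemma same_blockC i j : (j \in pblock P i) = (i \in pblock P j).
Proof. by rewrite !pblock_eq eq_sym. Qed.

Lemma precedes_inj a b b' : precedes P a b -> precedes P a b' -> b = b'.
Proof.
move=> /precedesP[ab lab minb] /precedesP[ab' lab' minb'].
by apply: val_inj; apply: anti_leq; rewrite minb ?minb'.
Qed.

Lemma precedes_uniq a a' b : precedes P a b -> precedes P a' b -> a = a'.
Proof.
move=> /precedesP[ab lab minb] /precedesP[ab' lab' minb'].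
have eqB : pblock P a = pblock P a'.
  by move: ab ab'; rewrite !pblock_eq => /eqP-> /eqP->.
have aa' : a' \in pblock P a by rewrite pblock_eq eqB.
have a'a : a \in pblock P a' by rewrite pblock_eq eqB.
case: (ltngtP a a') => [laa'|la'a|/val_inj//].
  by have := minb _ aa' laa'; rewrite leqNgt lab'.
by have := minb' _ a'a la'a; rewrite leqNgt lab.
Qed.

(** The predecessor is the largest element of the block below [i]; [j] shows that there is one. *)
Lemma precedes_exists i j :
  i \in pblock P j -> (j < i)%N -> exists a, precedes P a i.
Proof.
move=> ji lji; have good : (i \in pblock P j) && (j < i)%N by rewrite ji.
pose below (a : 'I_n) := (i \in pblock P a) && (a < i)%N.
case: (@arg_maxnP _ j below val good) => a /andP[ia lai] max_a.
exists a; apply/precedesP; split=> //.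
move=> k ak lak; rewrite leqNgt; apply/negP => lki.
have: (k <= a)%N.
  apply: max_a; rewrite /below lki andbT.
  by move: ia; rewrite !pblock_eq => /eqP<-; rewrite eq_sym -pblock_eq.
by rewrite leqNgt lak.
Qed.

Lemma singleton_eq i j : j \in pblock P i -> singleton P i -> j = i.
Proof.
have ii : i \in pblock P i by rewrite mem_pblock.
by move=> ij /cards1P[k ik]; move: ii ij; rewrite ik !inE => /eqP-> /eqP.
Qed.

(** Both sides express that [i] is not the minimum of its block. *)
Lemma closer_or_transientE i :
  closer P i || transient P i = [exists a, precedes P a i].
Proof.
apply/idP/existsP => [|[a /precedesP[ai lai _]]].
  move=> ct; have ns : ~~ singleton P i by case/orP: ct => [/andP[]|/and3P[]].
  have : ~~ [forall j in pblock P i, (i <= j)%N].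
    case/orP: ct => [/andP[_ /forallP clo]|/and3P[_ + _]]; last by rewrite /opener ns.
    (* A closer that is also the minimum of its block is alone in it. *)
    apply: contra ns => /forallP op; apply/cards1P; exists i; apply/setP=> j.
    rewrite inE; apply/idP/eqP => [ij|->]; last by rewrite mem_pblock.
    by apply: val_inj; apply: anti_leq; rewrite (implyP (clo j)) ?(implyP (op j)).
  rewrite negb_forall => /existsP[j]; rewrite negb_imply -ltnNge => /andP[ij lji].
  by apply: (precedes_exists (j := j)); rewrite // same_blockC.
have ia : a \in pblock P i by rewrite same_blockC.
have ns : ~~ singleton P i.
  by apply/negP=> /(singleton_eq ia) ai'; rewrite ai' ltnn in lai.
rewrite /transient ns /=; case: (closer P i) => //=; rewrite andbT /opener ns /=.
by apply/negP=> /forallP/(_ a); rewrite ia /= leqNgt lai.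
Qed.

Lemma precedes_opener a b : precedes P a b -> opener P a || transient P a.
Proof.
case/precedesP=> ab lab _.
have ns : ~~ singleton P a.
  by apply/negP=> /(singleton_eq ab) ab'; rewrite ab' ltnn in lab.
rewrite /transient ns /=; case: (opener P a) => //=; rewrite /closer ns /=.
by apply/negP=> /forallP/(_ b); rewrite ab /= leqNgt lab.
Qed.

End Partition.

Definition arcs_of n (P : {set {set 'I_n}}) : pred_fun n :=
  [ffun i => [pick a | precedes P a i]].

Lemma arcs_ofP n (P : {set {set 'I_n}}) a b : partition P [set: 'I_n] ->
  (arcs_of P b == Some a) = precedes P a b.
Proof.
move=> partP; rewrite ffunE; case: pickP => [a' a'b|-> //].
apply/eqP/idP => [[<-]//|ab]; congr Some; exact: precedes_uniq a'b ab.
Qed.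

Lemma arcs_of_diagram n (P : {set {set 'I_n}}) : partition P [set: 'I_n] ->
  arc_diagram (arcs_of P).
Proof.
move=> partP; apply/arc_diagramP=> a b /eqP; rewrite arcs_ofP // => ab.
split=> [|b' /eqP]; first by case/precedesP: ab.
by rewrite arcs_ofP // => ab'; apply: precedes_inj ab' ab.
Qed.

Lemma crossing_arcs_of n (P : {set {set 'I_n}}) (i : 'I_n) :
  partition P [set: 'I_n] -> crossing (arcs_of P) i = Gamma P i.
Proof.
move=> partP; apply/setP=> a; rewrite !inE andbCA; congr (_ && _).
apply/existsP/andP => [[b /andP[]]|[_ /existsP[b]]].
  rewrite arcs_ofP // => ab lib; split; first exact: precedes_opener ab.
  by apply/existsP; exists b; rewrite ab.
by rewrite -arcs_ofP // => ab; exists b.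
Qed.

(** [gamma] counts from 1 and [index] from 0; the default value 0 of [gamma] marks the absence of a
    predecessor. *)
Lemma step_weight_arcs_of (R : fieldType) (c w : nat -> R) n
    (P : {set {set 'I_n}}) (i : 'I_n) : partition P [set: 'I_n] ->
  step_weight c w (arcs_of P) i =
  c #|Gamma P i| * (if gamma P i is g.+1 then w g else 1).
Proof.
move=> partP; rewrite /step_weight crossing_arcs_of // ffunE /gamma.
by case: pickP.
Qed.

Lemma gamma_gt0 n (P : {set {set 'I_n}}) (i : 'I_n) : partition P [set: 'I_n] ->
  (0 < gamma P i)%N = closer P i || transient P i.
Proof.
move=> partP; rewrite closer_or_transientE // /gamma.
case: pickP => [a ai|none]; first by apply/esym/existsP; exists a.
by apply/esym/existsP=> -[a]; rewrite none.
Qed.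

(** Write each power as a product over all elements and exchange the products: [i] contributes to
    [c k] only at k = #Gamma_i + 1 and to [w k] only at k = gamma_i, both at most n. *)
Lemma prod_step_weight (R : fieldType) (c w : nat -> R) n (P : {set {set 'I_n}}) :
  partition P [set: 'I_n] ->
  \prod_(i < n) step_weight (fun h => c h.+1) (fun h => w h.+1) (arcs_of P) i =
  \prod_(1 <= k < n.+1) (c k ^+ ell P k.-1 * w k ^+ gstat P k).
Proof.
move=> partP; rewrite big_add1 big_mkord /=.
have leGn (i : 'I_n) : (#|Gamma P i| < n)%N.
  exact: leq_ltn_trans (card_Gamma P i) (ltn_ord i).
have legn (i : 'I_n) : (gamma P i <= n)%N.
  rewrite /gamma; case: pickP => // a _; apply: leq_ltn_trans (leGn i).
  by rewrite cardE index_size.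
have expE (x : R) (A : {set 'I_n}) : x ^+ #|A| = \prod_i (if i \in A then x else 1).
  by rewrite -prodr_const big_mkcond.
under [RHS]eq_bigr => k _ do rewrite !expE -big_split /=.
rewrite exchange_big /=; apply: eq_bigr => i _.
rewrite step_weight_arcs_of // big_split /=; congr (_ * _).
  rewrite (bigD1 (Ordinal (leGn i))) //= inE eqxx big1 ?mulr1 // => k.
  by rewrite inE -val_eqE /= eq_sym => /negbTE->.
case g: (gamma P i) => [|m].
  by rewrite big1 // => k _; rewrite inE g andbF.
have ltmn : (m < n)%N by rewrite -g legn.
rewrite (bigD1 (Ordinal ltmn)) //= inE -gamma_gt0 // g eqxx big1 ?mulr1 // => k.
by rewrite inE g eqSS -val_eqE /= eq_sym => /negbTE->; rewrite andbF.
Qed.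

(** * Recovering the blocks from the arcs *)

Definition retract n (p : pred_fun n) (i : 'I_n) : 'I_n := odflt i (p i).

(* n iterations of the predecessor reach the minimum of the block. *)
Definition chain_root n (p : pred_fun n) (i : 'I_n) : 'I_n :=
  iter n (retract p) i.

Section ChainRoot.
Variables (n : nat) (p : pred_fun n).
Hypothesis arcs : arc_diagram p.

Lemma retract_le i : (retract p i <= i)%N.
Proof.
rewrite /retract; case pi: (p i) => [a|] //=.
by case: (arc_diagramP _ arcs _ _ pi) => /ltnW.
Qed.

(** The iterates decrease strictly until they are fixed, so a start at most [m] needs at most [m]
    steps. *)
Lemma retract_iter m (i : 'I_n) : (i <= m)%N ->
  retract p (iter m (retract p) i) = iter m (retract p) i.
Proof.
elim: m i => [|m IHm] i lim.
  by apply: val_inj; apply/eqP; rewrite eqn_leq retract_le (leq_trans lim).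
rewrite !iterSr; have [fi|nfi] := eqVneq (retract p i) i.
  by rewrite fi iter_fix.
by apply: IHm; rewrite -ltnS (leq_trans _ lim) // ltn_neqAle nfi retract_le.
Qed.

Lemma retract_root i : retract p (chain_root p i) = chain_root p i.
Proof. by apply: retract_iter; apply: ltnW. Qed.

Lemma root_retract i : chain_root p (retract p i) = chain_root p i.
Proof. by rewrite /chain_root -iterSr iterS retract_iter // ltnW. Qed.

Lemma root_pred a b : p b = Some a -> chain_root p a = chain_root p b.
Proof. by move=> pb; rewrite -[RHS]root_retract /retract pb. Qed.

Lemma root_le i : (chain_root p i <= i)%N.
Proof.
suff le m : (iter m (retract p) i <= i)%N by exact: le.
by elim: m => //= m; apply: leq_trans; exact: retract_le.
Qed.

Lemma pred_root i : p (chain_root p i) = None.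
Proof.
case pr: (p (chain_root p i)) => [a|//]; have [] := arc_diagramP _ arcs _ _ pr.
by have := retract_root i; rewrite /retract pr /= => ->; rewrite ltnn.
Qed.

Lemma pred_exists a b : chain_root p a = chain_root p b -> (a < b)%N ->
  exists a', p b = Some a'.
Proof.
move=> rab lab; case pb: (p b) => [a'|]; first by exists a'.
have rb : chain_root p b = b.
  by apply: iter_fix; rewrite /retract pb.
by have := root_le a; rewrite rab rb leqNgt lab.
Qed.

(* No element of a class lies strictly between the ends of an arc of that class:
   following the arcs down from it would reach a, hence a second arc leaving a,
   or a shorter arc covering a. *)
Lemma arc_adjacent a b x : p b = Some a -> chain_root p x = chain_root p a ->
  (a < x)%N -> ~~ (x < b)%N.
Proof.
(* The measure is the right end of the arc plus the inner point: it drops to b + a' if a < a', and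
   to x + a if a' < a. *)
move: {2}(b + x)%N.+1 (ltnSn (b + x)%N) => k.
elim: k a b x => // k IHk a b x ltk pb rxa lax; apply/negP => lxb.
have [a' px] := pred_exists (esym rxa) lax.
have [la'x ux] := arc_diagramP _ arcs _ _ px.
have ra' := root_pred px.
case: (ltngtP a a') => [laa'|la'a|/val_inj aa'].
- have /negP[] : ~~ (a' < b)%N; last exact: ltn_trans la'x lxb.
  apply: (IHk a) => //; last by rewrite ra'.
  by rewrite ltnS in ltk; apply: leq_trans ltk; rewrite ltn_add2l.
- have /negP[] : ~~ (a < x)%N; last by [].
  apply: (IHk a') => //; last by rewrite ra' rxa.
  rewrite ltnS in ltk; apply: leq_trans ltk.
  by rewrite addnC ltn_add2r (ltn_trans lax).
by rewrite -aa' in ux; rewrite (ux b pb) ltnn in lxb.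
Qed.

(** An arc stays in one class, and [arc_adjacent] leaves no class member between its ends.
    Conversely, for [a] and [b] consecutive in a class, the arc into [b] can start neither after
    [a], by consecutiveness, nor before it, by [arc_adjacent]. *)
Lemma precedes_root a b :
  precedes (preim_partition (chain_root p) [set: 'I_n]) a b = (p b == Some a).
Proof.
have inb i j : (j \in pblock (preim_partition (chain_root p) [set: 'I_n]) i)
    = (chain_root p i == chain_root p j).
  apply: pblock_equivalence_partition; rewrite ?inE // => x y z _ _ _.
  by split=> // /eqP->.
apply/precedesP/eqP => [[]|pb].
  rewrite inb => /eqP rab lab minb; have [a' pb] := pred_exists rab lab.
  rewrite pb; congr Some; have ra' := root_pred pb.
  have [la'b _] := arc_diagramP _ arcs _ _ pb.
  case: (ltngtP a a') => [laa'|la'a|/val_inj//].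
    have : (b <= a')%N by apply: minb laa'; rewrite inb ra' rab.
    by rewrite leqNgt la'b.
  by have /negP[] := arc_adjacent pb (etrans rab (esym ra')) la'a.
have rab := root_pred pb; have [lab _] := arc_diagramP _ arcs _ _ pb.
split; rewrite ?inb ?rab // => j; rewrite inb => /eqP rj laj.
by rewrite leqNgt; apply: arc_adjacent pb _ laj; rewrite -rj.
Qed.

End ChainRoot.

(** Following predecessors stays in the block and stops at its minimum, so two elements share a root
    exactly when they share a block. *)
Lemma root_arcs_of n (P : {set {set 'I_n}}) : partition P [set: 'I_n] ->
  preim_partition (chain_root (arcs_of P)) [set: 'I_n] = P.
Proof.
move=> partP; rewrite -[RHS](preim_partition_pblock partP).
have tiP : trivIset P by case/and3P: partP.
have coverP i : i \in cover P by rewrite (cover_partition partP) inE.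
have arcs := arcs_of_diagram partP.
have block_retract i : pblock P (retract (arcs_of P) i) = pblock P i.
  rewrite /retract; case pi: (arcs_of P i) => [a|//] /=.
  move/eqP: pi; rewrite arcs_ofP // => /precedesP[ai _ _].
  by apply/eqP; rewrite eq_pblock.
have block_root i : pblock P (chain_root (arcs_of P) i) = pblock P i.
  suff: forall m, pblock P (iter m (retract (arcs_of P)) i) = pblock P i by apply.
  by elim=> //= m IHm; rewrite block_retract.
apply: eq_in_imset => i _; apply/setP=> j; rewrite !inE /=.
apply/eqP/eqP => [rij|bij]; first by rewrite -block_root rij block_root.
(* If one root were larger than another in its block, it would have a predecessor, against
   [pred_root]. *)
have root_min k l : pblock P k = pblock P l ->
    (chain_root (arcs_of P) k <= chain_root (arcs_of P) l)%N.
  move=> bkl; rewrite leqNgt; apply/negP=> lt_root.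
  have inb : chain_root (arcs_of P) k \in pblock P (chain_root (arcs_of P) l).
    by rewrite -eq_pblock // !block_root bkl.
  have [a] := precedes_exists partP inb lt_root.
  by rewrite -arcs_ofP // pred_root.
by apply: val_inj; apply: anti_leq; rewrite !root_min.
Qed.

(** [arcs_of] and the partition into classes of [chain_root] are mutually inverse, by [root_arcs_of]
    and [precedes_root]. *)
Lemma sum_partitions (R : fieldType) n (F : pred_fun n -> R) :
  \sum_(P : {set {set 'I_n}} | partition P [set: 'I_n]) F (arcs_of P) =
  \sum_(p | arc_diagram p) F p.
Proof.
rewrite [RHS](reindex_onto (@arcs_of n)
  (fun p => preim_partition (chain_root p) [set: 'I_n])) /=.
  apply: eq_bigl => P; apply/idP/andP => [partP|[_ /eqP <-]].
    by rewrite arcs_of_diagram ?root_arcs_of.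
  exact: preim_partitionP.
move=> p arcs; apply/ffunP=> b; apply/eqP.
case pb: (p b) => [a|].
  by rewrite arcs_ofP ?preim_partitionP // precedes_root ?pb.
by rewrite ffunE; case: pickP => // a; rewrite precedes_root // pb.
Qed.

Theorem proposition1p2 (R : realType) (c eps : nat -> R)
    (c_gt0 : forall k : nat, (1 <= k)%N -> 0 < c k)
    (eps_ge0 : forall k : nat, (1 <= k)%N -> 0 <= eps k)
    (n : nat) :
  stieltjes_moment (divergent_x c eps) (divergent_y c eps) n =
  \sum_(P : {set {set 'I_n}} | partition P [set: 'I_n])
    \prod_(1 <= k < n.+1)
      (c k ^+ ell P k.-1 * (1 + eps k) ^+ gstat P k).
Proof.
under eq_bigr => P partP.
  rewrite -(prod_step_weight c (fun k => 1 + eps k)) //; over.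
rewrite (sum_partitions (fun p => \prod_(i < n) step_weight _ _ p i)).
have sum_epsE h : \sum_(j < h) (1 + eps j.+1) =
    h%:R + \sum_(1 <= i < h.+1) eps i.
  by rewrite big_split sumr_const card_ord big_add1 big_mkord.
rewrite (eq_bigl (completions 0 set0)) => [|p].
  have := sum_completions (fun h => c h.+1) (fun h => 1 + eps h.+1) (leq0n n)
    (A := set0).
  rewrite cards0 subn0 => ->; last by move=> a; rewrite inE.
  (* It remains to compare the step weights with x and y; in the horizontal weight the extra 1 turns
     h into the index h + 1. *)
  apply: stieltjes_momentE => h; rewrite sum_epsE.
    by rewrite /divergent_y mulrA.
  by rewrite /divergent_x addrA -natr1 [1 + _]addrC.
by apply/idP/completionsP => [arcs|[]//]; split.
Qed.
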